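(* Let $r\ge 1$, let $M_r$ be the free metabelian group of rank $r$, and let $l\in\mathbb{N}$. Every finitely generated $l$-verbally closed subgroup $H$ of $M_r$ with $r_{ab}(H)=l+1$ is a retract of $M_r$.
   Context: $M_r=F_r/F_r''$ is the free group of rank $r$ in the variety of metabelian groups (solvable of derived length at most $2$), $F_r$ the free group of rank $r$. For a group $G$ with derived subgroup $G'$ and a finitely generated subgroup $H\le G$, $r_{ab}(H)$ is the minimal number of generators of $HG'/G'$. For $l\in\mathbb N$, a subgroup $H\le G$ is $l$-verbally closed in $G$ if for every $n$, every group words $w_1,\dots,w_l$ in variables $x_1,\dots,x_n$ (without constants) and every $h_1,\dots,h_l\in H$, if the system $w_i(x_1,\dots,x_n)=h_i$ ($i=1,\dots,l$) has a solution in $G$, then it has a solution in $H$. A subgroup $H\le G$ is a retract of $G$ if there is an endomorphism $\rho:G\to G$ with $\rho(G)\subseteq H$ that is the identity on $H$. *)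

(* Defs.v *)
From mathcomp Require Import all_boot.
Set Implicit Arguments. Unset Strict Implicit. Unset Printing Implicit Defensive.

Record group := Group {
  carrier :> Type;
  gmul : carrier -> carrier -> carrier;
  ginv : carrier -> carrier;
  gone : carrier;
  gmulA : forall a b c, gmul a (gmul b c) = gmul (gmul a b) c;
  gmul1 : forall a, gmul gone a = a;
  gmulg1 : forall a, gmul a gone = a;
  gmulV : forall a, gmul (ginv a) a = gone;
  gmulgV : forall a, gmul a (ginv a) = gone
}.

Section GroupDefs.
Variable G : group.

Inductive gen (S : G -> Prop) : G -> Prop :=
  | gen_base x : S x -> gen S x
  | gen_one : gen S (gone G)
  | gen_mul x y : gen S x -> gen S y -> gen S (gmul x y)
  | gen_inv x : gen S x -> gen S (ginv x).

Definition comm (a b : G) : G := gmul (gmul (ginv a) (ginv b)) (gmul a b).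

Definition derived (S : G -> Prop) : G -> Prop :=
  gen (fun z => exists a b, S a /\ S b /\ z = comm a b).

Definition derivedG : G -> Prop := derived (fun _ => True).

Definition metabelian : Prop := forall z, derived derivedG z -> z = gone G.

Definition fin_gen (H : G -> Prop) : Prop :=
  exists (k : nat) (g : 'I_k -> G),
    forall z, H z <-> gen (fun y => exists i, y = g i) z.

Inductive word (n : nat) : Type :=
  | wvar : 'I_n -> word n
  | wone : word n
  | wmul : word n -> word n -> word n
  | winv : word n -> word n.

Fixpoint weval (n : nat) (a : 'I_n -> G) (w : word n) : G :=
  match w with
  | wvar i => a i
  | wone => gone G
  | wmul u v => gmul (weval a u) (weval a v)
  | winv u => ginv (weval a u)
  end.

Definition verbally_closed (l : nat) (H : G -> Prop) : Prop :=
  forall (n : nat) (w : 'I_l -> word n) (h : 'I_l -> G),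
    (forall i, H (h i)) ->
    (exists a : 'I_n -> G, forall i, weval a (w i) = h i) ->
    exists a : 'I_n -> G, (forall j, H (a j)) /\ (forall i, weval a (w i) = h i).

Definition HGder (H : G -> Prop) : G -> Prop :=
  fun y => exists h c, H h /\ derivedG c /\ y = gmul h c.

(* HG'/G' is generated by k elements (cosets of g_1..g_k with g_i in HG'). *)
Definition ab_gen_by (H : G -> Prop) (k : nat) : Prop :=
  exists g : 'I_k -> G, (forall i, HGder H (g i)) /\
    forall y, HGder H y ->
      gen (fun z => (exists i, z = g i) \/ derivedG z) y.

Definition r_ab_eq (H : G -> Prop) (k : nat) : Prop :=
  ab_gen_by H k /\ forall k', k' < k -> ~ ab_gen_by H k'.

Definition is_hom (K : group) (f : G -> K) : Prop :=
  forall a b, f (gmul a b) = gmul (f a) (f b).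

Definition is_retract (H : G -> Prop) : Prop :=
  exists rho : G -> G, is_hom rho /\ (forall z, H (rho z)) /\
    (forall h, H h -> rho h = h).

End GroupDefs.

Definition IsFreeMetabelian (M : group) (r : nat) (x : 'I_r -> M) : Prop :=
  metabelian M /\
  forall (K : group), metabelian K -> forall f : 'I_r -> K,
    exists phi : M -> K, is_hom phi /\ (forall i, phi (x i) = f i) /\
      forall psi : M -> K, is_hom psi -> (forall i, psi (x i) = f i) ->
        forall m, psi m = phi m.

(* Main.v *)
(** Fox calculus embeds [M] into a Magnus group: an element is determined by its
    class [al m] in the lattice [A = Z^r] and by its flow [fl m], a finitely
    supported integral function on the edges of the Cayley graph of [A].
    Choose [h_0, ..., h_l] in [H] generating [H] modulo [M'].  They do not all
    commute, for otherwise [H M' / M'] would be cyclic; fix a pivot [h_j], put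
    [c_i = [h_i, h_j]] for the [l] other indices, and let [v_i] be [c_i] acted on
    by [B^(l+1) + sum_k B^k h_k] in [Z[A]], with [B] large.  Verbal closedness for
    the [l] equations [v_i(x) = v_i] gives an endomorphism [phi] of [M] with values
    in [H] and fixing every [v_i].  As flows are integral and [B] dominates the
    coefficients of [fl c_i], the equation [phi v_i = v_i] splits digit by digit in
    base [B]: [phi] fixes every [c_i] and the class of every [h_k].
    The defect [d m = fl (phi m) - fl m] is then a crossed homomorphism on [H], and
    [(1 - h_j) d m - (1 - m) d h_j] is one that vanishes on all [h_i].  An element
    of [H ∩ M'] is a word of zero exponent sums in [x], hence, by verbal closedness,
    the same word in elements of [H]; this pushes the values of that crossed
    homomorphism into every power of the augmentation ideal, so it is zero.  Thus
    [phi] is the identity on [H ∩ M'] and on [H / (H ∩ M')], so it is bijective on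
    [H], and [(phi|H)^-1 phi] is the retraction. *)
Require Import Defs.
From mathcomp Require Import all_boot.
From mathcomp Require Import all_order all_algebra.
From mathcomp Require Import boolp classical_sets functions fsbigop.
From mathcomp Require Import zify ring.
Set Implicit Arguments. Unset Strict Implicit. Unset Printing Implicit Defensive.
Import Order.TTheory GRing.Theory Num.Theory.

Declare Scope grp_scope.
Delimit Scope grp_scope with grp.
Notation "a * b" := (gmul a b) : grp_scope.
Notation "a ^-1" := (ginv a) : grp_scope.
Notation "1" := (gone _) : grp_scope.

(** * Group identities, products of powers, and congruence modulo the derived subgroup *)

Section GroupTheory.
Variable G : group.
Implicit Types (a b c : G).
Local Open Scope grp_scope.

Lemma gmulK a b : a * b * b^-1 = a.
Proof. by rewrite -gmulA gmulgV gmulg1. Qed.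

Lemma gmulVK a b : a * b^-1 * b = a.
Proof. by rewrite -gmulA gmulV gmulg1. Qed.

Lemma gmulI c a b : c * a = c * b -> a = b.
Proof. by move=> e; rewrite -[a]gmul1 -[b]gmul1 -(gmulV c) -!gmulA e. Qed.

Lemma gmulIr c a b : a * c = b * c -> a = b.
Proof. by move=> e; rewrite -[a](gmulK _ c) e gmulK. Qed.

Lemma ginv_eq a b : a * b = 1 -> b = a^-1.
Proof. by move=> e; apply: (@gmulI a); rewrite e gmulgV. Qed.

Lemma ginvM a b : (a * b)^-1 = b^-1 * a^-1.
Proof. by apply/esym/ginv_eq; rewrite gmulA gmulK gmulgV. Qed.

Lemma ginvK a : a^-1^-1 = a.
Proof. by apply/esym/ginv_eq; rewrite gmulV. Qed.

Lemma ginv1 : (gone G)^-1 = 1.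
Proof. by apply/esym/ginv_eq; rewrite gmul1. Qed.

Lemma comm_eq1 a b : comm a b = 1 <-> a * b = b * a.
Proof.
rewrite /comm -ginvM; split=> e; last by rewrite e gmulV.
by apply: (@gmulI (b * a)^-1); rewrite e gmulV.
Qed.

Fixpoint gpow a (n : nat) : G := if n is m.+1 then a * gpow a m else 1.

Definition gpowz a (z : int) : G :=
  match z with Posz n => gpow a n | Negz n => (gpow a n.+1)^-1 end.

Lemma gpowSr a n : gpow a n.+1 = gpow a n * a.
Proof.
elim: n => [|n IH]; first by rewrite /= gmul1 gmulg1.
by rewrite /= in IH *; rewrite -gmulA -IH.
Qed.

Lemma gpowzS a z : gpowz a (z + 1)%R = gpowz a z * a.
Proof.
case: z => [n|[|n]].
- have -> : (Posz n + 1 = Posz n.+1)%R by lia.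
  exact: gpowSr.
- have -> : (Negz 0 + 1 = 0)%R by [].
  by rewrite /= gmulg1 gmulV.
have -> : (Negz n.+1 + 1 = Negz n)%R by lia.
by rewrite /gpowz -[gpow a n.+2]/(a * gpow a n.+1) ginvM gmulVK.
Qed.

Lemma gpowzP a z : gpowz a (z - 1)%R = gpowz a z * a^-1.
Proof. by rewrite -[z in RHS](subrK 1%R) gpowzS gmulK. Qed.

Lemma gpowzD a z t : gpowz a (z + t)%R = gpowz a z * gpowz a t.
Proof.
elim: t => [|n IH|n IH] .
- by rewrite addr0 [gpowz a 0]/= gmulg1.
- by rewrite intS [(1 + _)%R]addrC addrA !gpowzS IH gmulA.
by rewrite intS opprD [(- 1 + _)%R]addrC addrA !gpowzP IH gmulA.
Qed.

Lemma gpowz1 a : gpowz a 1 = a. Proof. by rewrite /= gmulg1. Qed.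

Lemma gen_gpow S a n : gen S a -> gen S (gpow a n).
Proof.
by move=> Sa; elim: n => [|n IH] /=; [exact: gen_one|exact: gen_mul].
Qed.

Lemma gen_gpowz S a z : gen S a -> gen S (gpowz a z).
Proof.
by move=> Sa; case: z => n; [|apply: gen_inv]; apply: gen_gpow.
Qed.

Lemma gen_sub (S T : G -> Prop) a :
  (forall b, S b -> gen T b) -> gen S a -> gen T a.
Proof.
by move=> ST; elim=> [b /ST//||b c _ ? _ ?|b _ ?];
  [exact: gen_one|exact: gen_mul|exact: gen_inv].
Qed.

Lemma weval_gen S n (y : 'I_n -> G) w : (forall i, gen S (y i)) -> gen S (weval y w).
Proof.
move=> Sy; elim: w => [i||u Su v Sv|u Su] //=.
- exact: gen_one.
- exact: gen_mul.
exact: gen_inv.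
Qed.

Lemma gen_weval n (y : 'I_n -> G) a :
  gen (fun z => exists i, z = y i) a -> exists w, weval y w = a.
Proof.
elim=> [b [i ->]||b c _ [u <-] _ [v <-]|b _ [u <-]].
- by exists (wvar i).
- by exists (wone n).
- by exists (wmul u v).
by exists (winv u).
Qed.

(* Applied with [E] equality and with [E] congruence modulo the derived subgroup. *)
Section Congruence.
Variable E : G -> G -> Prop.
Hypothesis Erefl : forall a, E a a.
Hypothesis Esym : forall a b, E a b -> E b a.
Hypothesis Etrans : forall b a c, E a b -> E b c -> E a c.
Hypothesis Emul : forall a a' b b', E a a' -> E b b' -> E (a * b) (a' * b').

Let ecomm a b := E (a * b) (b * a).

Lemma ecommM a b c : ecomm a b -> ecomm a c -> ecomm a (b * c).
Proof.
move=> ab ac; rewrite /ecomm gmulA.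
apply: (Etrans (Emul ab (Erefl c))).
by rewrite -!gmulA; apply: Emul.
Qed.

Lemma ecommV a b : ecomm a b -> ecomm a b^-1.
Proof.
move=> ab; have := Emul (Emul (Erefl b^-1) ab) (Erefl b^-1).
rewrite !gmulA gmulV gmul1 -[_ * b * b^-1]gmulA gmulgV gmulg1.
exact: Esym.
Qed.

Lemma ecommX a b z : ecomm a b -> ecomm a (gpowz b z).
Proof.
move=> ab.
have ec1 : ecomm a 1 by rewrite /ecomm gmulg1 gmul1.
have ecX n : ecomm a (gpow b n) by elim: n => [//|n IH]; apply: ecommM.
by case: z => n; [|apply: ecommV]; apply: ecX.
Qed.

Variables (I : eqType) (y : I -> G).
Hypothesis yC : forall i j, ecomm (y i) (y j).

Definition powprod (s : seq I) (v : I -> int) : G :=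
  foldr (fun i acc => gpowz (y i) (v i) * acc) 1 s.

Lemma ecomm_powprod a s v : (forall i, ecomm a (y i)) -> ecomm a (powprod s v).
Proof.
move=> ay; elim: s => [|i s IH] /=; first by rewrite /ecomm gmulg1 gmul1.
by apply: ecommM => //; apply: ecommX.
Qed.

Lemma powprodD s u v :
  E (powprod s (fun i => u i + v i)%R) (powprod s u * powprod s v).
Proof.
elim: s => [|i s IH] /=; first by rewrite gmul1.
rewrite gpowzD -!gmulA.
apply: Emul => //; apply: (Etrans (Emul (Erefl _) IH)).
rewrite !gmulA; apply: Emul => //.
by apply: ecomm_powprod => j; apply/Esym/ecommX.
Qed.

Lemma powprod0 s v : (forall i, v i = 0%R) -> powprod s v = 1.
Proof. by move=> v0; elim: s => [//|i s /= ->]; rewrite v0 gmul1. Qed.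

Lemma powprod1 s i v : uniq s -> i \in s -> (forall j, v j = (j == i)%:R%R) ->
  powprod s v = y i.
Proof.
move=> us si vE.
have p0 (s' : seq I) : i \notin s' -> powprod s' v = 1.
  elim: s' => [//|j s' IH]; rewrite inE negb_or => /andP[ij /IH /= ->].
  by rewrite vE eq_sym (negbTE ij) gmulg1.
elim: s us si => [//|j s IH] /= /andP[js us]; rewrite inE.
case: eqVneq => [eij _|ij /= si].
  by rewrite -eij in js *; rewrite p0 // vE eqxx gpowz1 gmulg1.
by rewrite vE eq_sym (negbTE ij) gmul1 IH.
Qed.

End Congruence.

Lemma derived_comm a b : derivedG (comm a b).
Proof. by apply: gen_base; exists a, b. Qed.

Lemma derivedG_conj a z : derivedG z -> derivedG (a * z * a^-1).
Proof.
move=> dz; rewrite -[a * z](gmul1) -(gmulgV z) -!gmulA; apply: gen_mul => //.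
by rewrite [a * _]gmulA; have := derived_comm z a^-1; rewrite /comm ginvK -!gmulA.
Qed.

Definition dcong a b : Prop := derivedG (a * b^-1).

Lemma dcong_refl a : dcong a a.
Proof. by rewrite /dcong gmulgV; exact: gen_one. Qed.

Lemma dcong_sym a b : dcong a b -> dcong b a.
Proof. by move/gen_inv; rewrite ginvM ginvK. Qed.

Lemma dcong_trans b a c : dcong a b -> dcong b c -> dcong a c.
Proof. by move=> ab /(gen_mul ab); rewrite gmulA gmulVK. Qed.

Lemma dcong_mul a a' b b' : dcong a a' -> dcong b b' -> dcong (a * b) (a' * b').
Proof.
rewrite /dcong => da db; rewrite ginvM -!gmulA [b * _]gmulA.
have := gen_mul (derivedG_conj a db) da.
by rewrite -!gmulA [a^-1 * _]gmulA gmulV gmul1.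
Qed.

Lemma dcongC a b : dcong (a * b) (b * a).
Proof.
rewrite /dcong ginvM.
by have := derived_comm a^-1 b^-1; rewrite /comm !ginvK !gmulA.
Qed.

Lemma metabelian_derivedC : metabelian G ->
  forall a b, derivedG a -> derivedG b -> a * b = b * a.
Proof.
move=> mG a b da db; apply/comm_eq1/mG/gen_base.
by exists a, b.
Qed.

End GroupTheory.

Section Hom.
Variables (G K : group) (f : G -> K).
Hypothesis fM : is_hom f.

Lemma hom1 : f (gone G) = gone K.
Proof. by apply: (@gmulI _ (f (gone G))); rewrite -fM gmul1 gmulg1. Qed.

Lemma homV a : f (ginv a) = ginv (f a).
Proof. by apply: ginv_eq; rewrite -fM gmulgV hom1. Qed.

Lemma hom_weval n (y : 'I_n -> G) w : f (weval y w) = weval (f \o y) w.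
Proof. by elim: w => [i||u IHu v IHv|u IHu] //=; rewrite ?hom1 ?fM ?homV ?IHu ?IHv. Qed.

Lemma hom_gpow a n : f (gpow a n) = gpow (f a) n.
Proof. by elim: n => [|n IH] /=; rewrite ?hom1 // fM IH. Qed.

End Hom.

(** Since [p] has abelian target, the derived subgroup lies in its kernel, and elements of the
    kernel commute. *)
Lemma ker_metabelian (K : group) (A : zmodType) (p : K -> A) :
  (forall a b, p (gmul a b) = (p a + p b)%R) ->
  (forall a b, p a = 0%R -> p b = 0%R -> gmul a b = gmul b a) ->
  metabelian K.
Proof.
move=> pM pC.
have p1 : p (gone K) = 0%R by apply: (@addrI _ (p (gone K))); rewrite -pM gmul1 addr0.
have pV a : p (ginv a) = (- p a)%R.
  by apply: (@addrI _ (p a)); rewrite -pM gmulgV p1 subrr.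
have pd z : derivedG z -> p z = 0%R.
  elim=> [_ [a [b [_ [_ ->]]]]||a b _ pa _ pb|a _ pa] //.
  - by rewrite /comm !pM !pV -opprD addNr.
  - by rewrite pM pa pb addr0.
  by rewrite pV pa oppr0.
move=> z; elim=> [_ [a [b [da [db ->]]]]||a b _ -> _ ->|a _ ->] //.
- by apply/comm_eq1/pC; apply: pd.
- exact: gmul1.
exact: ginv1.
Qed.

(** * Integral flows on the Cayley graph of [Z^r] under translation *)

Section Flows.
Local Open Scope ring_scope.
Variable r : nat.

Definition lattice := {ffun 'I_r -> int}.
Definition edge := ('I_r * lattice)%type.
Definition flow := edge -> int.

Implicit Types (a b : lattice) (u v : flow) (z : edge).

Definition act a v : flow := fun z => v (z.1, z.2 - a).

Lemma actA a b v : act (a + b) v = act a (act b v).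
Proof. by apply/funext => z; rewrite /act /= opprD addrA. Qed.

Lemma act0 v : act 0 v = v.
Proof. by apply/funext => -[i x]; rewrite /act subr0. Qed.

Lemma actD a u v : act a (u + v) = act a u + act a v. Proof. by []. Qed.
Lemma actN a v : act a (- v) = - act a v. Proof. by []. Qed.
Lemma act_zero a : act a 0 = 0. Proof. by []. Qed.
Lemma actAC a b v : act a (act b v) = act b (act a v).
Proof. by rewrite -!actA addrC. Qed.
Lemma actK a v : act (- a) (act a v) = v.
Proof. by rewrite -actA addNr act0. Qed.
Lemma actMn a v n : act a (v *+ n) = act a v *+ n.
Proof. by elim: n => [//|n IH]; rewrite !mulrS actD IH. Qed.

(** With [u], [v] the values of a crossed homomorphism at two elements of classes [a], [b], this
    says that multiplying it by [1 - c] and subtracting the principal one of [w] leaves a crossed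
    homomorphism. *)
Lemma crossed_sub_principal u v w a b c :
  u + act a v - act c (u + act a v) - (w - act (a + b) w) =
  u - act c u - (w - act a w) + act a (v - act c v - (w - act b w)).
Proof.
have -> : act a (v - act c v - (w - act b w)) =
    act a v - act c (act a v) - (act a w - act (a + b) w).
  by rewrite actAC actA.
rewrite actD; apply/funext => z; rewrite !fctE; lia.
Qed.

Definition fsup v := exists s : seq edge, forall z, z \notin s -> v z = 0.

Lemma fsup_uniq v : fsup v -> exists s, uniq s /\ forall z, z \notin s -> v z = 0.
Proof.
move=> [s sv]; exists (undup s); rewrite undup_uniq; split=> // z.
by rewrite mem_undup; exact: sv.
Qed.

Lemma fsup0 : fsup 0. Proof. by exists [::]. Qed.

Lemma fsupD u v : fsup u -> fsup v -> fsup (u + v).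
Proof.
move=> [s su] [t tv]; exists (s ++ t) => z; rewrite mem_cat negb_or => /andP[zs zt].
by rewrite addrfctE su ?tv.
Qed.

Lemma fsupN v : fsup v -> fsup (- v).
Proof. by move=> [s sv]; exists s => z zs; rewrite opprfctE sv ?oppr0. Qed.

Lemma fsup_act a v : fsup v -> fsup (act a v).
Proof.
move=> [s sv]; exists [seq (z.1, z.2 + a) | z <- s] => z zs; apply: sv.
apply: contra zs => zs; apply/mapP; exists (z.1, z.2 - a) => //=.
by rewrite subrK; case: z {zs}.
Qed.

Lemma fsup_bound v : fsup v -> exists N : nat, forall z, `|v z| <= N%:Z.
Proof.
move=> [s sv]; exists (\max_(z <- s) `|v z|%N)%N => z.
have [zs|/sv ->] := boolP (z \in s); last by rewrite normr0.
by rewrite -abszE lez_nat (@leq_bigmax_seq _ _ xpredT (fun z => `|v z|%N)).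
Qed.

(* A translation-invariant finite set is empty: look at a coordinate of [a]. *)
Lemma act_fix a v : fsup v -> act a v = v -> a != 0 -> v = 0.
Proof.
move=> [s sv] av a0.
have [i ai] : exists i, a i != 0.
  apply/existsP; apply: contraNT a0 => /existsPn a0; apply/eqP/ffunP => i.
  by rewrite ffunE; apply/eqP; rewrite -[_ == _]negbK.
pose C := (\max_(z <- s) `|z.2 i|%N)%N.
have Cs z : v z != 0 -> (`|z.2 i|%N <= C)%N.
  move=> vz; have zs : z \in s by apply: contraNT vz => /sv ->.
  by rewrite (@leq_bigmax_seq _ _ xpredT (fun z : edge => `|z.2 i|%N)).
apply/funext => z; apply/eqP; apply: contraT => vz.
have vk k : v (z.1, z.2 - a *+ k) = v z.
  elim: k => [|k <-]; first by rewrite mulr0n subr0; case: z {vz}.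
  by rewrite -[in RHS]av /act /= mulrSr opprD addrA.
(* This multiple of [a] is long enough to carry coordinate [i] of [z] beyond the bound [C] of the
   support. *)
have := Cs (z.1, z.2 - a *+ (`|z.2 i|%N + C).+1).
rewrite vk => /(_ vz) /=; rewrite !ffunE.
have -> : (a *+ (`|z.2 i|%N + C).+1) i = a i *+ (`|z.2 i|%N + C).+1.
  by elim: (_.+1) => [|k IH]; rewrite ?mulr0n ?ffunE // !mulrS ffunE IH.
rewrite -mulr_natr natz; clearbody C; move: (a i) ai (z.2 i) => x x0 y; nia.
Qed.

(** The digit [w 0] is a multiple of [B] and smaller than [B] in absolute value, so it is zero;
    divide by [B] and repeat. *)
Lemma digits (B : int) m (w : nat -> int) :
  (forall k, (k < m)%N -> `|w k| < B) -> \sum_(k < m) B ^+ k * w k = 0 ->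
  forall k, (k < m)%N -> w k = 0.
Proof.
elim: m w => [//|m IH] w wB; rewrite big_ord_recl expr0 mul1r /=.
under eq_bigr => k _ do rewrite /bump /= add1n exprS -mulrA.
rewrite -mulr_sumr => e.
have s0 : \sum_(k < m) B ^+ k * w k.+1 = 0.
  have := wB 0%N isT; move: (\sum_(_ < m) _) e => x; move: (w 0%N) => y e.
  have -> : y = - (B * x) by apply/eqP; rewrite -addr_eq0 e.
  have [-> //|x0] := eqVneq x 0.
  rewrite normrN normrM => h; exfalso.
  have B0 : 0 < `|B| by lia.
  have : `|B| * 1 <= `|B| * `|x| by rewrite ler_pM2l //; lia.
  by lia.
have w0 : w 0%N = 0 by rewrite s0 mulr0 addr0 in e.
by case=> [//|k] km; apply: (IH (w \o succn)) => // j jm; apply: wB.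
Qed.

Lemma geometric_bound (B : int) m : 3 <= B -> \sum_(k < m) B ^+ k * 2 <= B ^+ m.
Proof.
move=> B3; elim: m => [|m IH]; first by rewrite big_ord0.
rewrite big_ord_recr /= exprS; have : 0 <= B ^+ m by rewrite exprn_ge0 //; lia.
move: IH; move: (\sum_(_ < m) _) (B ^+ m) => x y; nia.
Qed.

(* [F] is only known to be bounded; comparing the terms of top weight bounds it
   by [3 * N], and then the equation says that the digits in base [B] of two
   numbers coincide. *)
Lemma weighted_translates (F n : flow) (a b : nat -> lattice) m (N B : nat) :
  (forall z, `|n z| <= N%:Z) -> (4 * N + 3 <= B)%N -> fsup F ->
  (forall z, \sum_(k < m.+1) B%:Z ^+ k * act (b k) F z =
             \sum_(k < m.+1) B%:Z ^+ k * act (a k) n z) ->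
  forall k, (k <= m)%N -> act (b k) F = act (a k) n.
Proof.
move=> nN NB /fsup_bound[C FC] e.
have B3 : 3 <= B%:Z by lia.
(* The weights below the top weight [P] add up to at most half of [P]; [g] is their doubled sum,
   which avoids division. *)
pose g := \sum_(k < m) B%:Z ^+ k * 2; pose P := B%:Z ^+ m.
have gP : g <= P by exact: geometric_bound.
have P0 : 0 < P by rewrite exprn_gt0 //; lia.
have sum_le (c : int) (w : nat -> int) : (forall k, `|w k| <= c) ->
    `|\sum_(k < m) B%:Z ^+ k * w k| * 2 <= g * c.
  move=> wc; rewrite /g mulr_suml -[2 in X in X <= _]ger0_norm // -normrM.
  rewrite mulr_suml; apply: le_trans (ler_norm_sum _ _ _) _; apply: ler_sum => k _.
  rewrite !normrM normrX [`|B%:Z|]ger0_norm // [`|2|]ger0_norm // mulrAC.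
  by apply: ler_wpM2l (wc k); rewrite mulr_ge0 // exprn_ge0.
(* At the edge where the top term reads [F y], the lower terms give
   [|F y| <= N + (3 * N + j + 1) / 2 + N / 2], so the excess over [3 * N] drops by at least one. *)
have descent (j : nat) : (forall z, `|F z| <= 3 * N%:Z + j%:Z) ->
    forall z, `|F z| <= 3 * N%:Z.
  elim: j => [|j IH] Fj; first by move=> z; have := Fj z; rewrite addr0.
  apply: IH => y.
  pose z : edge := (y.1, y.2 + b m).
  have zy : act (b m) F z = F y by rewrite /act /= addrK; case: (y).
  have := e z; rewrite !big_ord_recr /= zy -/P.
  have := sum_le _ (fun k => act (b k) F z) (fun k => Fj _).
  have := sum_le _ (fun k => act (a k) n z) (fun k => nN _).
  move: (\sum_(_ < m) _) (\sum_(_ < m) _) => s t hs ht eP.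
  have := nN (z.1, z.2 - a m); rewrite -/(act (a m) n z).
  have : P * (`|F y| * 2) <= P * (6 * N%:Z + j.+1%:Z).
    have -> : P * (`|F y| * 2) = `|P * F y| * 2.
      by rewrite normrM ger0_norm ?mulrA // ltW.
    have hN : `|P * act (a m) n z| <= P * N%:Z.
      rewrite normrM (ger0_norm (ltW P0)) ler_pM2l //; exact: nN.
    have gc : g * (3 * N%:Z + j.+1%:Z) <= P * (3 * N%:Z + j.+1%:Z).
      by apply: ler_wpM2r.
    have gN : g * N%:Z <= P * N%:Z by apply: ler_wpM2r.
    rewrite !mulrDr in gc ht *.
    move: (P * act _ _ _) (P * F y) eP hN => p q eP hN.
    move: gc gN hs ht; lia.
  rewrite ler_pM2l //; lia.
have FN : forall z, `|F z| <= 3 * N%:Z.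
  by apply: (descent C) => z; apply: le_trans (FC z) _; lia.
(* The differences of corresponding terms are at most [3 * N + N], hence smaller than [B]. *)
move=> k km; apply/funext => z; apply/eqP; rewrite -subr_eq0; apply/eqP.
apply: (@digits B%:Z m.+1 (fun k => act (b k) F z - act (a k) n z)) => //.
  move=> {km}k _; have := FN (z.1, z.2 - b k); have := nN (z.1, z.2 - a k).
  by rewrite -/(act (b k) F z) -/(act (a k) n z); lia.
under eq_bigr => j _ do rewrite mulrBr.
by rewrite sumrB e subrr.
Qed.

(** * Pairing flows with polynomial functions: powers of the augmentation ideal *)

Definition pairing v (p : edge -> int) : int := \sum_(z \in [set: edge]) v z * p z.

Lemma pairingE s v p : uniq s -> (forall z, z \notin s -> v z = 0) ->
  pairing v p = \sum_(z <- s) v z * p z.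
Proof.
move=> us sv; rewrite /pairing (fsbigE s) //.
  by apply: eq_bigl => z; rewrite in_setT.
by move=> z _ /sv ->; rewrite mul0r.
Qed.

Lemma pairing0 p : pairing 0 p = 0.
Proof. by rewrite /pairing fsbig1 // => z _; rewrite mul0r. Qed.

Lemma pairingDl u v p : fsup u -> fsup v -> pairing (u + v) p = pairing u p + pairing v p.
Proof.
move=> [s su] [t tv]; pose q := undup (s ++ t).
have qs z : z \notin q -> z \notin s /\ z \notin t.
  by rewrite mem_undup mem_cat negb_or => /andP[].
have uq : uniq q by exact: undup_uniq.
rewrite !(@pairingE q) -?big_split //=.
- by apply: eq_bigr => z _; rewrite addrfctE mulrDl.
- by move=> z /qs[_ /tv].
- by move=> z /qs[/su].
by move=> z /qs[zs zt]; rewrite addrfctE su ?tv.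
Qed.

Lemma pairingBr v p q : fsup v -> pairing v (fun z => p z - q z) = pairing v p - pairing v q.
Proof.
move=> /fsup_uniq[s [us sv]]; rewrite !(pairingE _ us) // -sumrB.
by apply: eq_bigr => z _; rewrite mulrBr.
Qed.

Lemma pairing_act a v p : fsup v ->
  pairing (act a v) p = pairing v (fun z => p (z.1, z.2 + a)).
Proof.
move=> /fsup_uniq[s [us sv]]; rewrite (pairingE _ us sv).
have us' : uniq [seq (z.1, z.2 + a) | z <- s].
  by rewrite map_inj_uniq // => -[i y] [j z] /= [-> /addIr ->].
rewrite (pairingE _ us').
  by rewrite big_map; apply: eq_bigr => -[i z] _; rewrite /act /= addrK.
move=> z zs; apply: sv; apply: contra zs => zs; apply/mapP.
by exists (z.1, z.2 - a) => //=; rewrite subrK; case: z {zs}.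
Qed.

(* Functions on edges that are polynomial of degree [< k] in the base point. *)
Fixpoint polyfun k (p : edge -> int) : Prop :=
  if k is k'.+1 then forall a, polyfun k' (fun z => p (z.1, z.2 + a) - p z)
  else forall z, p z = 0.

Lemma eq_polyfun k p q : p =1 q -> polyfun k p -> polyfun k q.
Proof. by move=> /funext ->. Qed.

Lemma polyfun_shift k p a : polyfun k p -> polyfun k (fun z => p (z.1, z.2 + a)).
Proof.
elim: k p => [|k IH] p pk /=; first by move=> z; rewrite pk.
move=> b; apply: eq_polyfun (IH _ (pk b)) => z /=.
by rewrite addrAC.
Qed.

Lemma polyfunD k p q : polyfun k p -> polyfun k q -> polyfun k (fun z => p z + q z).
Proof.
elim: k p q => [|k IH] p q pk qk /=; first by move=> z; rewrite pk qk.
by move=> a; apply: eq_polyfun (IH _ _ (pk a) (qk a)) => z; rewrite opprD addrACA.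
Qed.

Lemma polyfunZ k c p : polyfun k p -> polyfun k (fun z => c * p z).
Proof.
elim: k p => [|k IH] p pk /=; first by move=> z; rewrite pk mulr0.
by move=> a; apply: eq_polyfun (IH _ (pk a)) => z; rewrite mulrBr.
Qed.

Lemma polyfunM k i c p : polyfun k p -> polyfun k.+1 (fun z => (z.2 i - c) * p z).
Proof.
elim: k p => [|k IH] p pk.
  by move=> a z /=; rewrite !pk !mulr0 subrr.
move=> a; apply: eq_polyfun (polyfunD (IH _ (pk a)) (polyfunZ (a i) (polyfun_shift a pk))).
by move=> z /=; rewrite ffunE; ring.
Qed.

(** Multiply one factor per point of [s]: the indicator of a different edge label, which costs no
    degree, or a coordinate difference, which raises the degree by one. *)
Lemma interpolation (z0 : edge) (s : seq edge) : z0 \notin s ->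
  exists k p, [/\ polyfun k p, p z0 != 0 & forall z, z \in s -> p z = 0].
Proof.
elim: s => [_|z s IH].
  exists 1%N, (fun z => (z.1 == z0.1)%:R); split=> //; last by rewrite eqxx.
  by move=> a z /=; rewrite subrr.
rewrite inE negb_or => /andP[z0z /IH[k [p [pk p0 ps]]]].
have [e1|n1] := eqVneq z0.1 z.1; last first.
  exists k, (fun y => (y.1 != z.1)%:R * p y); split.
  - elim: k p pk {p0 ps} => [|k IHk] p pk /=; first by move=> y; rewrite pk mulr0.
    by move=> a; apply: eq_polyfun (IHk _ (pk a)) => y /=; rewrite mulrBr.
  - by rewrite n1 mul1r.
  by move=> y; rewrite inE => /orP[/eqP ->|/ps ->]; rewrite ?mulr0 // eqxx mul0r.
have [i zi] : exists i, z0.2 i != z.2 i.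
  apply/existsP; apply: contraNT z0z => /existsPn e2.
  rewrite -pair_eqE /pair_eq /= e1 eqxx /=; apply/eqP/ffunP => i.
  by apply/eqP; rewrite -[_ == _]negbK.
exists k.+1, (fun y : edge => (y.2 i - z.2 i) * p y); split.
- exact: polyfunM.
- by rewrite mulf_neq0 // subr_eq0.
by move=> y; rewrite inE => /orP[/eqP ->|/ps ->]; rewrite ?mulr0 // subrr mul0r.
Qed.

(* For finitely supported [v]: [v] lies in [I^k Z[Z^r]^r], where [I] is the
   augmentation ideal of [Z[Z^r]]. *)
Definition order_ge k v := forall p, polyfun k p -> pairing v p = 0.

Lemma order_ge0 v : order_ge 0 v.
Proof.
by move=> p p0; rewrite /pairing fsbig1 // => z _; rewrite p0 mulr0.
Qed.

Lemma order_ge_act k a v : fsup v -> order_ge k v -> order_ge k (act a v).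
Proof. by move=> sv vk p pk; rewrite pairing_act //; apply/vk/polyfun_shift. Qed.

Lemma order_ge_inf v : fsup v -> (forall k, order_ge k v) -> v = 0.
Proof.
move=> /fsup_uniq[s [us sv]] vk; apply/funext => z.
have [zs|/sv//] := boolP (z \in s).
have [|k [p [pk p0 ps]]] := @interpolation z (rem z s).
  by rewrite mem_rem_uniq // !inE eqxx.
have := vk k p pk; rewrite (pairingE _ us sv) (perm_big _ (perm_to_rem zs)) big_cons.
rewrite big1_seq => [|y /andP[_ /ps ->]]; last by rewrite mulr0.
by rewrite /= addr0 => /eqP; rewrite mulf_eq0 (negbTE p0) orbF => /eqP.
Qed.

End Flows.

(** * Subgroups as groups, and generation of [M] by its basis *)

Lemma hom_derived (G K : group) (f : G -> K) (S : G -> Prop) (T : K -> Prop) z :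
  is_hom f -> (forall a, S a -> T (f a)) -> derived S z -> derived T (f z).
Proof.
move=> fM ST; elim=> [_ [a [b [Sa [Sb ->]]]]||a b _ Ta _ Tb|a _ Ta].
- apply: gen_base; exists (f a), (f b); split; [exact: ST|split; first exact: ST].
  by rewrite /comm !fM !(homV fM).
- by rewrite hom1 //; exact: gen_one.
- by rewrite fM; exact: gen_mul.
by rewrite homV //; exact: gen_inv.
Qed.

Section Subgroup.
Variables (G : group) (S : G -> Prop).

Let T := {a : G | gen S a}.
Let mulT (a b : T) : T := exist _ _ (gen_mul (svalP a) (svalP b)).
Let invT (a : T) : T := exist _ _ (gen_inv (svalP a)).
Let oneT : T := exist _ _ (gen_one S).

Let val_injT (a b : T) : sval a = sval b -> a = b.
Proof.
by case: a b => [a ga] [b gb] /= e; move: gb; rewrite -e => gb; rewrite (Prop_irrelevance ga gb).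
Qed.

Definition subgroup : group.
Proof.
apply: (@Defs.Group T mulT invT oneT) => *; apply: val_injT => /=;
  [exact: gmulA|exact: gmul1|exact: gmulg1|exact: gmulV|exact: gmulgV].
Defined.

Definition subgroup_val (a : subgroup) : G := sval (a : T).

Lemma subgroup_val_hom : is_hom subgroup_val. Proof. by []. Qed.

Lemma subgroup_metabelian : metabelian G -> metabelian subgroup.
Proof.
move=> mG z dz; apply: val_injT => /=; apply: mG.
apply: (hom_derived subgroup_val_hom) dz => a.
exact: (hom_derived subgroup_val_hom).
Qed.

End Subgroup.

(** The universal map into the subgroup generated by the basis, followed by the inclusion, is the
    identity by uniqueness. *)
Lemma free_metabelian_gen (M : group) r (x : 'I_r -> M) : IsFreeMetabelian x ->
  forall m, gen (fun y => exists i, y = x i) m.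
Proof.
case=> mM univ m; set S := fun y => _.
pose xS i : subgroup S := exist _ (x i) (gen_base (ex_intro _ i erefl)).
have [phi [phiM [phix _]]] := univ _ (subgroup_metabelian mM) xS.
have [id' [_ [_ uniq_id]]] := univ M mM x.
have <- : subgroup_val (phi m) = m.
  transitivity (id' m); last by apply/esym/(uniq_id id).
  apply: (uniq_id (fun m => subgroup_val (phi m))) => [a b|i].
    by rewrite phiM.
  by rewrite phix.
exact: svalP (phi m).
Qed.

(** * Two metabelian target groups for the universal property *)

Section HeisenbergGroup.
Local Open Scope ring_scope.

(** Unitriangular integral 3 x 3 matrices, the last entry of the triple being the corner. *)
Definition heisenberg : group.
Proof.
apply: (@Defs.Group (int * int * int)%type
  (fun g h => (g.1.1 + h.1.1, g.1.2 + h.1.2, g.2 + h.2 + g.1.1 * h.1.2))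
  (fun g => (- g.1.1, - g.1.2, - g.2 + g.1.1 * g.1.2)) (0, 0, 0)).
- by move=> [[a b] c] [[a' b'] c'] [[a'' b''] c''] /=; congr (_, _, _); ring.
- by move=> [[a b] c] /=; congr (_, _, _); ring.
- by move=> [[a b] c] /=; congr (_, _, _); ring.
- by move=> [[a b] c] /=; congr (_, _, _); ring.
by move=> [[a b] c] /=; congr (_, _, _); ring.
Defined.

Lemma heisenberg_metabelian : metabelian heisenberg.
Proof.
apply: (@ker_metabelian heisenberg (int * int)%type (fun g => g.1)) => // g h.
case: g h => [[a b] c] [[a' b'] c'] /= [-> ->] [-> ->].
by congr (_, _, _); ring.
Qed.

End HeisenbergGroup.

Section MagnusGroup.
Local Open Scope ring_scope.
Variable r : nat.

(** The semidirect product of flows by the lattice. Supports are unrestricted here; finiteness on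
    the image of [M] is proved in [fl_fsup]. *)
Definition magnus : group.
Proof.
apply: (@Defs.Group (lattice r * flow r)%type
  (fun g h => (g.1 + h.1, g.2 + act g.1 h.2))
  (fun g => (- g.1, - act (- g.1) g.2)) (0, 0)).
- by move=> [a u] [b v] [c w] /=; rewrite actD actA !addrA.
- by move=> [a u] /=; rewrite act0 !add0r.
- by move=> [a u] /=; rewrite !addr0.
- by move=> [a u] /=; rewrite !addNr.
by move=> [a u] /=; rewrite actN -actA !addrN act0 addrN.
Defined.

Lemma magnus_metabelian : metabelian magnus.
Proof.
apply: (@ker_metabelian magnus (lattice r) (fun g => g.1)) => // -[a u] [b v] /= -> ->.
by rewrite !act0 [u + v]addrC.
Qed.

End MagnusGroup.

(** * The Magnus embedding and its injectivity *)

Section MagnusEmbedding.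
Local Open Scope ring_scope.
Variables (M : group) (r : nat) (x : 'I_r -> M).
Hypothesis hM : IsFreeMetabelian x.

Definition unit_vec (i : 'I_r) : lattice r := [ffun j => (j == i)%:R].

(* [al m] is the end point and [fl m] the flow of a path in the Cayley graph of
   [Z^r]; [fl] collects the Fox derivatives. *)
Definition magnus_coords (al : M -> lattice r) (fl : M -> flow r) : Prop :=
  [/\ forall m n, al (gmul m n) = al m + al n,
      forall m n, fl (gmul m n) = fl m + act (al m) (fl n),
      forall i, al (x i) = unit_vec i &
      forall i, fl (x i) = fun z => (z == (i, 0))%:R].

Lemma magnus_coords_ex : exists al fl, magnus_coords al fl.
Proof.
have [phi [phiM [phix _]]] := hM.2 _ (@magnus_metabelian r)
  (fun i => (unit_vec i, fun z => (z == (i, 0))%:R)).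
exists (fun m => (phi m).1), (fun m => (phi m).2).
by split=> [m n|m n|i|i]; rewrite ?phiM ?phix.
Qed.

Variables (al : M -> lattice r) (fl : M -> flow r).
Hypothesis coords : magnus_coords al fl.

Local Notation gens := (free_metabelian_gen hM).

Lemma alM m n : al (gmul m n) = al m + al n. Proof. by case: coords. Qed.
Lemma flM m n : fl (gmul m n) = fl m + act (al m) (fl n). Proof. by case: coords. Qed.
Lemma al1 : al (gone M) = 0.
Proof. by apply: (@addrI _ (al (gone M))); rewrite -alM gmul1 addr0. Qed.
Lemma alV m : al (ginv m) = - al m.
Proof. by apply: (@addrI _ (al m)); rewrite -alM gmulgV al1 subrr. Qed.
Lemma fl1 : fl (gone M) = 0.
Proof.
have := flM (gone M) (gone M); rewrite gmul1 al1 act0 => e.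
by apply: (@addrI _ (fl (gone M))); rewrite addr0 -e.
Qed.
Lemma flV m : fl (ginv m) = - act (- al m) (fl m).
Proof.
apply: (@addIr _ (act (- al m) (fl m))).
by rewrite addNr -alV -flM gmulV fl1.
Qed.

Lemma al_gpowz m z : al (gpowz m z) = al m *~ z.
Proof.
elim: z => [|n IH|n IH]; first by rewrite al1.
  by rewrite -addn1 PoszD gpowzS alM IH mulrzDr.
by rewrite -addn1 PoszD opprD gpowzP alM alV IH mulrzDr.
Qed.

Lemma al_derived m : derivedG m -> al m = 0.
Proof.
elim=> [_ [a [b [_ [_ ->]]]]||a b _ pa _ pb|a _ pa].
- by rewrite /comm !alM !alV -opprD addNr.
- exact: al1.
- by rewrite alM pa pb addr0.
by rewrite alV pa oppr0.
Qed.

Lemma fl_fsup m : fsup (fl m).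
Proof.
elim: (gens m) => [_ [i ->]||a b _ sa _ sb|a _ sa].
- case: coords => _ _ _ ->; exists [:: (i, 0)] => z.
  by rewrite inE => /negbTE ->.
- by rewrite fl1; exact: fsup0.
- by rewrite flM; apply: fsupD => //; exact: fsup_act.
by rewrite flV; apply/fsupN/fsup_act.
Qed.

(** The transversal of [M'] formed by the ordered monomials in the basis. *)
Definition trans (a : lattice r) : M := powprod x (enum 'I_r) a.

Lemma transD a b : dcong (trans (a + b)) (gmul (trans a) (trans b)).
Proof.
rewrite /trans.
have -> : (a + b : 'I_r -> int) = (fun i => a i + b i).
  by apply/funext => i; rewrite ffunE.
apply: powprodD => //; [exact: dcong_refl|exact: dcong_sym|exact: dcong_trans| |].
  exact: dcong_mul.
by move=> i j; exact: dcongC.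
Qed.

Lemma trans0 : trans 0 = gone M.
Proof. by apply: powprod0 => i; rewrite ffunE. Qed.

Lemma trans_unit i : trans (unit_vec i) = x i.
Proof.
by apply: powprod1; rewrite ?enum_uniq ?mem_enum // => j; rewrite ffunE.
Qed.

Lemma dcong_trans_al m : dcong m (trans (al m)).
Proof.
elim: (gens m) => [_ [i ->]||a b _ ea _ eb|a _ ea].
- by case: coords => _ _ -> _; rewrite trans_unit; exact: dcong_refl.
- by rewrite al1 trans0; exact: dcong_refl.
- rewrite alM; apply: dcong_trans (dcong_sym (transD _ _)).
  exact: dcong_mul.
rewrite alV.
have e0 : dcong (gmul (trans (- al a)) (trans (al a))) (gone M).
  by rewrite -trans0 -(addNr (al a)); apply/dcong_sym/transD.
apply/dcong_sym.
have := dcong_mul e0 (dcong_refl (ginv a)); rewrite gmul1; apply: dcong_trans.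
rewrite -gmulA -[X in dcong X _]gmulg1; apply: dcong_mul; first exact: dcong_refl.
by rewrite -(gmulgV a); apply: dcong_mul => //; exact: dcong_refl.
Qed.

Lemma ker_al m : al m = 0 -> derivedG m.
Proof.
by move=> e; have := dcong_trans_al m; rewrite e trans0 /dcong ginv1 gmulg1.
Qed.

(* The Schreier generator of [M'] attached to an edge. *)
Definition edge_gen (z : edge r) : M :=
  gmul (gmul (trans z.2) (x z.1)) (ginv (trans (z.2 + unit_vec z.1))).

Lemma edge_gen_derived z : derivedG (edge_gen z).
Proof.
apply: (@dcong_sym _ (trans (z.2 + unit_vec z.1)) (gmul (trans z.2) (x z.1))).
by rewrite -trans_unit; exact: transD.
Qed.

Lemma edge_genC y z : gmul (edge_gen y) (edge_gen z) = gmul (edge_gen z) (edge_gen y).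
Proof. by apply: (metabelian_derivedC hM.1); exact: edge_gen_derived. Qed.

Lemma edge_prodD s u v :
  powprod edge_gen s (u + v) = gmul (powprod edge_gen s u) (powprod edge_gen s v).
Proof.
apply: (@powprodD _ eq) => //; [by move=> b a c ->|by move=> a a' b b' -> ->|].
exact: edge_genC.
Qed.

(* Schreier rewriting: the flow of [n] determines [n] up to the end point. *)
Lemma schreier n a : exists s0 : seq (edge r), forall s : seq (edge r), uniq s -> {subset s0 <= s} ->
  gmul (trans a) n = gmul (powprod edge_gen s (act a (fl n))) (trans (a + al n)).
Proof.
elim: (gens n) a => {n} [_ [i ->]||m n _ IHm _ IHn|n _ IHn] a.
- exists [:: (i, a)] => s us ss; case: coords => _ _ -> ->.
  rewrite (@powprod1 _ _ _ _ (i, a)) ?gmulVK // ?ss ?inE //.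
  move=> [j b]; rewrite /act -!pair_eqE /pair_eq /= subr_eq0 //.
- exists [::] => s us _; rewrite al1 addr0 fl1 powprod0 //.
  by rewrite gmulg1 gmul1.
- have [s1 h1] := IHm a; have [s2 h2] := IHn (a + al m).
  exists (s1 ++ s2) => s us ss.
  rewrite alM flM actD edge_prodD gmulA (h1 s) //; last first.
    by move=> z zs; apply: ss; rewrite mem_cat zs.
  rewrite -gmulA (h2 s) //; last by move=> z zs; apply: ss; rewrite mem_cat zs orbT.
  by rewrite -actA addrA gmulA.
(* For an inverse, the induction hypothesis is used from the far end of the path, [a - al n], and
   [n] is cancelled. *)
have [s0 h0] := IHn (a - al n); exists s0 => s us ss.
have := h0 s us ss; rewrite subrK alV flV actN -actA => e.
apply: (@gmulIr _ n); rewrite gmulVK -gmulA e gmulA -edge_prodD addNr powprod0 //.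
by rewrite gmul1.
Qed.

(** Schreier rewriting from the base point 0 expresses [n] as a product of edge generators whose
    exponents are all zero. *)
Lemma magnus_inj1 n : al n = 0 -> fl n = 0 -> n = gone M.
Proof.
move=> an fn; have [s0 h] := schreier n 0.
have := h (undup s0) (undup_uniq _); rewrite an fn addr0 act_zero trans0 !gmul1.
by rewrite powprod0 // gmul1; apply=> z; rewrite mem_undup.
Qed.

Lemma magnus_inj m n : al m = al n -> fl m = fl n -> m = n.
Proof.
move=> ea ef; apply: (@gmulIr _ (ginv n)); rewrite gmulgV; apply: magnus_inj1.
  by rewrite alM alV ea subrr.
by rewrite flM flV actN -actA ea subrr act0 ef subrr.
Qed.

End MagnusEmbedding.

(** * Noncommuting pairs, vanishing of crossed homomorphisms, and the criterion for a retract *)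

Section Retract.
Local Open Scope ring_scope.
Variables (M : group) (r : nat) (x : 'I_r -> M).
Hypothesis hM : IsFreeMetabelian x.
Variables (al : M -> lattice r) (fl : M -> flow r).
Hypothesis coords : magnus_coords x al fl.

Local Notation gens := (free_metabelian_gen hM).
Let alM := alM coords.
Let alV := alV coords.
Let flM := flM coords.
Let flV := flV coords.

(** Map to the Heisenberg group by coordinates [p] and [q]: the corners of the two products differ
    by this 2 x 2 minor. *)
Lemma al_comm_parallel m n : gmul m n = gmul n m ->
  forall p q, al m p * al n q = al m q * al n p.
Proof.
move=> mn p q.
have [phi [phiM [phix _]]] := hM.2 _ heisenberg_metabelian
  (fun i => (unit_vec i p, unit_vec i q, 0)).
have phi1 k : (phi k).1 = (al k p, al k q).
  elim: (gens k) => {k} [_ [i ->]||a b _ IHa _ IHb|a _ IHa].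
  - by rewrite phix; case: coords => _ _ -> _.
  - by rewrite (hom1 phiM) (al1 coords) !ffunE.
  - by rewrite phiM alM /= IHa IHb !ffunE.
  by rewrite (homV phiM) alV /= IHa !ffunE.
have := congr1 (fun k => (phi k).2) mn; rewrite !phiM /= !phi1 /=.
by move: (phi m).2 (phi n).2 => s t; lia.
Qed.

Variable H : M -> Prop.
Hypothesis Hsub : forall m, gen H m -> H m.

Let H1 : H (gone M). Proof. by apply: Hsub; exact: gen_one. Qed.
Let HM a b : H a -> H b -> H (gmul a b).
Proof. by move=> Ha Hb; apply: Hsub; apply: gen_mul; exact: gen_base. Qed.
Let HV a : H a -> H (ginv a).
Proof. by move=> Ha; apply: Hsub; apply: gen_inv; exact: gen_base. Qed.

Lemma parallel_cyclic :
  (forall a b, H a -> H b -> forall p q, al a p * al b q = al a q * al b p) ->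
  ab_gen_by H 1.
Proof.
move=> par.
suff [h0 [Hh0 h0P]] : exists h0, H h0 /\
    forall a, H a -> exists k : int, al a = al h0 *~ k.
  exists (fun=> h0); split.
    move=> _; exists h0, (gone M); split=> //; split; first exact: gen_one.
    by rewrite gmulg1.
  move=> _ [a [c [Ha [dc ->]]]]; have [k ak] := h0P a Ha.
  apply: gen_mul; last by apply: gen_base; right.
  rewrite -[a](gmulVK _ (gpowz h0 k)); apply: gen_mul.
    apply/gen_base; right; apply: (ker_al hM coords).
    by rewrite alM alV (al_gpowz coords) ak subrr.
  by apply/gen_gpowz/gen_base; left; exists ord0.
(* If no class has a positive coordinate then, passing to inverses, all classes are zero. Otherwise
   divide with remainder along a coordinate [p]. *)
have [[p [b0 [Hb0 b0p]]]|noP] := pselect (exists p b, H b /\ 0 < al b p); last first.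
  exists (gone M); split=> // a Ha; exists 0; rewrite mulr0z; apply/ffunP => p.
  rewrite [RHS]ffunE; apply/eqP; rewrite eq_le !leNgt; apply/andP; split; apply/negP => ap.
    by apply: noP; exists p, a.
  by apply: noP; exists p, (ginv a); rewrite alV ffunE oppr_gt0; split=> //; exact: HV.
(* The least positive value of coordinate [p] on [H] is [n.+1], attained at [h0]. *)
pose P n := `[< exists b, H b /\ al b p = n.+1%:Z >].
have exP : exists n, P n.
  exists (`|al b0 p|.-1)%N; apply/asboolP; exists b0; split=> //; lia.
have [n /asboolP[h0 [Hh0 h0p]] nmin] := ex_minnP exP.
exists h0; split=> // a Ha; exists (al a p %/ n.+1)%Z.
pose b := gmul a (ginv (gpowz h0 (al a p %/ n.+1)%Z)).
have Hb : H b by apply/HM/HV/Hsub/gen_gpowz/gen_base.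
have bE : al b = al a - al h0 *~ (al a p %/ n.+1)%Z.
  by rewrite alM alV (al_gpowz coords).
have zE (v : lattice r) k q : (v *~ k) q = v q * k.
  elim: k => [|k IH|k IH]; first by rewrite mulr0z ffunE mulr0.
    by rewrite -addn1 PoszD mulrzDr ffunE IH mulrDr mulr1z mulr1.
  by rewrite -addn1 PoszD opprD mulrzDr ffunE IH mulrDr mulrN1z ffunE mulrN1.
have bp : al b p = (al a p %% n.+1)%Z.
  by rewrite bE !ffunE zE h0p /modz mulrC.
have bp0 : al b p = 0.
  have : 0 <= al b p < n.+1%:Z by rewrite bp modz_ge0 // ltz_pmod.
  case E: (al b p) => [[|k]|k] // /andP[_ kn].
  have : P k by apply/asboolP; exists b.
  by move/nmin; lia.
(* The remainder is parallel to [al h0] and has zero coordinate [p], where [al h0] is nonzero. *)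
apply/eqP; rewrite -subr_eq0 -bE; apply/eqP/ffunP => q; rewrite [RHS]ffunE.
have := par b h0 Hb Hh0 q p; rewrite bp0 h0p mul0r => /eqP.
by rewrite mulf_eq0 => /orP[/eqP|/eqP].
Qed.

Section Generators.
Variables (l : nat) (h : 'I_l -> M).
Hypothesis hH : forall i, H (h i).

Local Notation H0 := (gen (fun z => exists i, z = h i)).

Hypothesis al_H : forall a, H a -> exists w, H0 w /\ al a = al w.

Lemma noncommuting_pair : ~ ab_gen_by H 1 ->
  exists i j, gmul (h i) (h j) <> gmul (h j) (h i) /\ al (h j) != 0.
Proof.
move=> nc; apply: contrapT => noij; apply: nc.
have hC i j : gmul (h i) (h j) = gmul (h j) (h i).
  have [aj|aj] := eqVneq (al (h j)) 0; last first.
    by apply: contrapT => nij; apply: noij; exists i, j.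
  have [ai|ai] := eqVneq (al (h i)) 0.
    by apply: (metabelian_derivedC hM.1); apply: (ker_al hM coords).
  by apply: contrapT => nij; apply: noij; exists j, i; split=> // e; apply: nij.
apply: parallel_cyclic => a b Ha Hb p q.
have [u [H0u ->]] := al_H Ha; have [v [H0v ->]] := al_H Hb.
elim: H0u => {a Ha} [_ [i ->]||a a' _ IH _ IH'|a _ IH].
- elim: H0v => {b Hb} [_ [j ->]||b b' _ IH _ IH'|b _ IH].
  + exact: al_comm_parallel.
  + by rewrite (al1 coords) !ffunE !mulr0.
  + by rewrite alM !ffunE !mulrDr IH IH'.
  + by rewrite alV !ffunE !mulrN IH.
- by rewrite (al1 coords) !ffunE !mul0r.
- by rewrite alM !ffunE !mulrDl IH IH'.
by rewrite alV !ffunE !mulNr IH.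
Qed.

(* On [H] the map [d] is a homomorphism modulo [order_ge k.+1] as soon as its
   values lie in [order_ge k]; being zero on [H0], it gains one order on
   [H ∩ M'], hence on [H], each time. *)
Lemma crossed_hom_eq0 (d : M -> flow r) :
  (forall a b, H a -> H b -> d (gmul a b) = d a + act (al a) (d b)) ->
  (forall a, fsup (d a)) -> (forall i, d (h i) = 0) ->
  (forall a, H a -> al a = 0 -> exists (w : word r) (y : 'I_r -> M),
     [/\ forall i, H (y i), weval y w = a & al (weval x w) = 0]) ->
  forall a, H a -> d a = 0.
Proof.
move=> dM dfs dh vc.
have d1 : d (gone M) = 0.
  have := dM _ _ H1 H1; rewrite gmul1 (al1 coords) act0 => e.
  by apply: (@addrI _ (d (gone M))); rewrite addr0 -e.
have dV a : H a -> d (ginv a) = - act (- al a) (d a).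
  move=> Ha; apply: (@addIr _ (act (- al a) (d a))).
  by rewrite addNr -alV -dM ?gmulV //; exact: HV.
have H0H w : H0 w -> H w.
  by elim=> [_ [i ->]||b b' _ ? _ ?|b _ ?] //; [exact: HM|exact: HV].
have dH0 w : H0 w -> d w = 0.
  elim=> [_ [i ->]||b b' /H0H Hb db /H0H Hb' db'|b /H0H Hb db] //.
    by rewrite dM // db db' act_zero addr0.
  by rewrite dV // db act_zero oppr0.
suff ord k a : H a -> order_ge k (d a).
  by move=> a Ha; apply: order_ge_inf => // k; exact: ord.
elim: k a => [|k IH] a Ha; first exact: order_ge0.
have ker n : H n -> al n = 0 -> order_ge k.+1 (d n).
  move=> Hn n0 p pk; have [w [y [Hy <- w0]]] := vc n Hn n0.
  (* The difference of [p] and its translate has lower degree, so it pairs to zero with [d b] by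
     induction. *)
  have shift b (b' : lattice r) : H b -> pairing (act b' (d b)) p = pairing (d b) p.
    move=> Hb; apply/eqP; rewrite -subr_eq0 pairing_act // -pairingBr //.
    by rewrite IH.
  have Hw u : H (weval y u).
    by apply/Hsub/weval_gen => i; exact: gen_base.
  (* Hence pairing with [p] turns [d] into a homomorphism on words, which depends only on exponent
     sums. *)
  have homP u : pairing (d (weval y u)) p =
      \sum_i al (weval x u) i * pairing (d (y i)) p.
    elim: u => [i||u IHu v IHv|u IHu] /=.
    - rewrite (bigD1 i) //= big1 => [|j ji]; case: coords => _ _ -> _.
        by rewrite ffunE eqxx mul1r addr0.
      by rewrite ffunE (negbTE ji) mul0r.
    - rewrite d1 (al1 coords) big1 => [|i _]; last by rewrite ffunE mul0r.
      exact: pairing0.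
    - rewrite dM // pairingDl ?shift //; last exact: fsup_act.
      by rewrite IHu IHv -big_split /=; apply: eq_bigr => i _; rewrite alM ffunE mulrDl.
    have HVu := HV (Hw u).
    have : pairing (d (gmul (weval y u) (ginv (weval y u)))) p = 0.
      by rewrite gmulgV d1 pairing0.
    rewrite dM // pairingDl ?shift //; last exact: fsup_act.
    move=> /eqP; rewrite addrC addr_eq0 => /eqP ->; rewrite IHu -sumrN.
    by apply: eq_bigr => i _; rewrite alV ffunE mulNr.
  by rewrite homP w0 big1 // => i _; rewrite ffunE mul0r.
have [w [H0w aw]] := al_H Ha.
have Hwa : H (gmul (ginv w) a) by apply: HM => //; apply/HV/H0H.
have -> : a = gmul w (gmul (ginv w) a) by rewrite gmulA gmulgV gmul1.
rewrite dM //; last exact: H0H.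
rewrite dH0 // add0r; apply: order_ge_act => //; apply: ker => //.
by rewrite alM alV aw addNr.
Qed.

End Generators.

(* Five lemma: [phi] is bijective on [H] since it is the identity on
   [H ∩ M'] and on [H / (H ∩ M')]. *)
Lemma retract_of_kernel_fix (phi : M -> M) : is_hom phi -> (forall m, H (phi m)) ->
  (forall a, H a -> al (phi a) = al a) ->
  (forall a, H a -> al a = 0 -> phi a = a) -> is_retract H.
Proof.
move=> phiM Hphi alphi fixN.
have inj a b : H a -> H b -> phi a = phi b -> a = b.
  move=> Ha Hb e; have Hab := HM Ha (HV Hb).
  have : phi (gmul a (ginv b)) = gone M by rewrite phiM (homV phiM) e gmulgV.
  rewrite fixN // => [ab|]; last by rewrite alM alV -alphi // -[al b]alphi // e subrr.
  by apply: (@gmulIr _ (ginv b)); rewrite gmulgV.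
have surj b : H b -> exists a, H a /\ phi a = b.
  (* The correction [n] lies in [H ∩ M'], so [phi] fixes it and [b n] is a preimage of [b]. *)
  move=> Hb; pose n := gmul (ginv (phi b)) b.
  have Hn : H n by apply: HM => //; apply: HV.
  have n0 : al n = 0 by rewrite alM alV alphi // addNr.
  exists (gmul b n); split; first exact: HM.
  by rewrite phiM (fixN n) // /n gmulA gmulgV gmul1.
have /choice[rho rhoP] : forall m, exists a, H a /\ phi a = phi m.
  by move=> m; apply: surj.
exists rho; split; last split.
- move=> a b; apply: inj; [exact: (rhoP _).1|apply: HM; exact: (rhoP _).1|].
  by rewrite phiM (rhoP _).2 (rhoP a).2 (rhoP b).2 phiM.
- by move=> z; exact: (rhoP z).1.
by move=> a Ha; apply: inj => //; [exact: (rhoP a).1|exact: (rhoP a).2].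
Qed.

End Retract.

(** * Commutators twisted by base [B] weights *)

Section RigidElements.
Local Open Scope ring_scope.
Variables (M : group) (r : nat) (x : 'I_r -> M).
Hypothesis hM : IsFreeMetabelian x.
Variables (al : M -> lattice r) (fl : M -> flow r).
Hypothesis coords : magnus_coords x al fl.

Let alM := alM coords.
Let alV := alV coords.
Let flM := flM coords.
Let flV := flV coords.

(** With the inverses on the right, the flow is [(1 - b) fl a - (1 - a) fl b], free of inverse
    translations. *)
Definition lcomm (K : group) (a b : K) : K :=
  gmul (gmul (gmul a b) (ginv a)) (ginv b).

Lemma hom_lcomm (K : group) (f : M -> K) a b : is_hom f ->
  f (lcomm a b) = lcomm (f a) (f b).
Proof. by move=> fM; rewrite /lcomm !fM !(homV fM). Qed.

Lemma lcomm_eq1 (K : group) (a b : K) : lcomm a b = gone K -> gmul a b = gmul b a.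
Proof.
rewrite /lcomm -gmulA -ginvM => e.
by apply: (@gmulIr _ (ginv (gmul b a))); rewrite e gmulgV.
Qed.

Lemma al_lcomm a b : al (lcomm a b) = 0.
Proof. by rewrite /lcomm !alM !alV [al a + al b]addrC addrK subrr. Qed.

Lemma fl_lcomm a b : fl (lcomm a b) = fl a + act (al a) (fl b) - act (al b) (fl a) - fl b.
Proof.
rewrite /lcomm !flM !flV !alM !alV !actN -!actA.
by rewrite [al a + al b]addrC addrK subrr act0.
Qed.

(* The element of [M'] obtained by acting on [c] with the element
   [\sum_(k < n) B ^ k al (g k)] of the group ring. *)
Fixpoint twisted (K : group) (g : nat -> K) (c : K) (B n : nat) : K :=
  if n is k.+1 then
    gmul (twisted g c B k) (gmul (gmul (g k) (gpow c (B ^ k))) (ginv (g k)))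
  else gone K.

Lemma hom_twisted (K : group) (f : M -> K) g c B n : is_hom f ->
  f (twisted g c B n) = twisted (f \o g) (f c) B n.
Proof.
move=> fM; elim: n => [|k IH] /=; first exact: hom1.
by rewrite !fM IH (homV fM) (hom_gpow fM).
Qed.

Lemma gen_twisted S (g : nat -> M) c B n : (forall k, gen S (g k)) -> gen S c ->
  gen S (twisted g c B n).
Proof.
move=> Sg Sc; elim: n => [|k IH] /=; first exact: gen_one.
apply: gen_mul => //; apply: gen_mul; last exact: gen_inv.
by apply: gen_mul => //; exact: gen_gpow.
Qed.

Lemma al_fl_gpow c n : al c = 0 -> al (gpow c n) = 0 /\ fl (gpow c n) = fl c *+ n.
Proof.
move=> c0; elim: n => [|n [IHa IHf]] /=; first by rewrite (al1 coords) (fl1 coords).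
by rewrite alM flM c0 IHa IHf act0 addr0 mulrS.
Qed.

Lemma al_twisted g c B n : al c = 0 -> al (twisted g c B n) = 0.
Proof.
move=> c0; elim: n => [|k IH] /=; first exact: (al1 coords).
by rewrite !alM alV IH (al_fl_gpow _ c0).1 addr0 add0r subrr.
Qed.

Lemma fl_twisted g c B n z : al c = 0 ->
  fl (twisted g c B n) z = \sum_(k < n) B%:Z ^+ k * act (al (g k)) (fl c) z.
Proof.
move=> c0; elim: n => [|k IH] /=; first by rewrite (fl1 coords) big_ord0.
have [ac fc] := al_fl_gpow (B ^ k) c0.
rewrite flM al_twisted // act0 addrfctE IH big_ord_recr /=; congr (_ + _).
rewrite !flM flV !alM ac addr0 actN -actA subrr act0 fc addrAC subrr add0r.
by rewrite actMn natmulfctE -mulr_natl natrX natz.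
Qed.

(** Equal flows of the twisted element and its image give an equation between weighted translates of
    [fl (phi c)] and [fl c]; as [c] is a commutator, [phi c] has trivial class too. *)
Lemma twisted_rigid (phi : M -> M) (g : nat -> M) a b m N B : is_hom phi ->
  let c := lcomm a b in
  (forall z, `|fl c z| <= N%:Z) -> (4 * N + 3 <= B)%N ->
  phi (twisted g c B m.+1) = twisted g c B m.+1 ->
  forall k, (k <= m)%N -> act (al (phi (g k))) (fl (phi c)) = act (al (g k)) (fl c).
Proof.
move=> phiM c cN NB e.
apply: (weighted_translates cN NB (fl_fsup hM coords _)) => z.
rewrite -(fl_twisted g B m.+1 z (al_lcomm a b)) -/c -e (hom_twisted _ _ _ _ phiM).
by rewrite fl_twisted // /c (hom_lcomm _ _ phiM) al_lcomm.
Qed.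

End RigidElements.

(** * Construction of [phi] from verbal closedness and analysis of its defect on [H] *)

Theorem theorem4 (r : nat) (hr : 1 <= r) (M : group) (x : 'I_r -> M)
  (hM : @IsFreeMetabelian M r x) (l : nat) (hl : 1 <= l) (H : M -> Prop)
  (hfg : fin_gen H) (hvc : verbally_closed l H) (hab : r_ab_eq H l.+1) :
  is_retract H.
Proof.
have [al [fl coords]] := magnus_coords_ex hM.
have alM := alM coords; have alV := alV coords; have flM := flM coords.
have Hsub m : gen H m -> H m.
  have [k [g gH]] := hfg; move=> Hm; apply/gH; apply: gen_sub Hm => b Hb.
  exact/gH.
have Hgen m : H m -> gen H m by exact: gen_base.
have H1 : H (gone M) by apply: Hsub; exact: gen_one.
have [[g [gH ggen]] hmin] := hab.
have /choice[h hP] : forall i, exists a, H a /\ al (g i) = al a.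
  move=> i; have [a [c [Ha [dc ->]]]] := gH i; exists a; split=> //.
  by rewrite alM (al_derived coords dc) addr0.
have hH i : H (h i) := (hP i).1.
pose H0 := gen (fun z => exists i, z = h i).
have al_H a : H a -> exists w, H0 w /\ al a = al w.
  move=> Ha; have : HGder H a.
    by exists a, (gone M); split=> //; split; [exact: gen_one|rewrite gmulg1].
  move/ggen; elim=> [b [[i ->]|dc]||b b' _ [w [Hw e]] _ [w' [Hw' e']]|b _ [w [Hw e]]].
  - by exists (h i); split; [apply: gen_base; exists i|exact: (hP i).2].
  - by exists (gone M); split; [exact: gen_one|rewrite (al_derived coords dc) (al1 coords)].
  - by exists (gone M); split; first exact: gen_one.
  - by exists (gmul w w'); split; [exact: gen_mul|rewrite !alM e e'].
  by exists (ginv w); split; [exact: gen_inv|rewrite !alV e].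
have [i [j [nij aj]]] := noncommuting_pair hM coords Hsub al_H (hmin 1%N hl).
have ji : j != i by apply/eqP => e; apply: nij; rewrite e.
have [i0 ei _] := unlift_some ji.
(* The map [lift j] enumerates the [l] indices other than [j], so there are exactly as many
   commutators as equations allowed. *)
pose c k := lcomm (h (lift j k)) (h j).
have Hc k : H (c k).
  apply: Hsub; rewrite /c /lcomm; repeat apply: gen_mul; try apply: gen_inv;
  exact: Hgen.
have al_c k : al (c k) = 0%R by exact: (al_lcomm coords).
have c_neq1 : fl (c i0) <> 0%R.
  move=> f0; apply: nij; rewrite ei; apply/lcomm_eq1.
  exact: (magnus_inj1 hM coords (al_c i0) f0).
have /choice[N0 N0P] : forall k, exists N : nat, forall z, (`|fl (c k) z| <= N%:Z)%R.
  by move=> k; apply/fsup_bound/(fl_fsup hM coords).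
pose N := \max_k N0 k; pose B := 4 * N + 3.
have NP k z : (`|fl (c k) z| <= N%:Z)%R.
  by apply: le_trans (N0P k z) _; rewrite lez_nat; exact: leq_bigmax.
(* Weights [0] to [l] carry the [h k]; the default value [gone M] at [l.+1] supplies the untwisted
   top term. *)
pose gg (k : nat) : M := if insub k is Some i then h (i : 'I_l.+1) else gone M.
have ggH k : H (gg k) by rewrite /gg; case: insubP.
have gg_ord (k : 'I_l.+1) : gg k = h k by rewrite /gg valK.
have gg_last : gg l.+1 = gone M by rewrite /gg insubF // ltnn.
pose v k := twisted gg (c k) B l.+2.
have /choice[W WP] : forall k, exists w : word r, weval x w = v k.
  by move=> k; apply/gen_weval/(free_metabelian_gen hM).
have [|y [Hy yW]] := hvc r W v _ (ex_intro _ x WP).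
  by move=> k; apply/Hsub/gen_twisted; [move=> ?|]; exact: Hgen.
have [phi [phiM [phix _]]] := hM.2 M hM.1 y.
have phi_weval w : phi (weval x w) = weval y w.
  rewrite (hom_weval phiM); congr weval; exact/funext.
have Hphi m : H (phi m).
  have [w <-] := gen_weval (free_metabelian_gen hM m).
  by rewrite phi_weval; apply/Hsub/weval_gen => k; exact: Hgen.
have phiv k : phi (v k) = v k by rewrite -[in LHS]WP phi_weval yW.
have rigid k :=
  twisted_rigid (g := gg) (m := l.+1) (B := B) hM coords phiM (NP k) (leqnn _) (phiv k).
have fl_phic k : fl (phi (c k)) = fl (c k).
  by have := rigid k l.+1 (leqnn _); rewrite gg_last (hom1 phiM) (al1 coords) !act0.
have al_phih k : al (phi (h k)) = al (h k).
  (* The change in the class of [h k] would be a translation fixing the nonzero flow of [c i0]. *)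
  have := rigid i0 k (ltnW (ltn_ord k)); rewrite gg_ord -/(c i0) fl_phic => e.
  apply/eqP; rewrite -subr_eq0; apply: contraT => n0; case: c_neq1.
  apply: act_fix n0; first exact: (fl_fsup hM coords).
  by rewrite addrC actA e actK.
have al_phi_der n : al n = 0%R -> al (phi n) = 0%R.
  move=> n0; apply: (al_derived coords).
  exact: (hom_derived phiM) (ker_al hM coords n0).
have H0H w : H0 w -> H w by move=> Hw; apply/Hsub/(gen_sub _ Hw) => _ [k ->]; exact: Hgen.
have al_phi a : H a -> al (phi a) = al a.
  move=> Ha; have [w [H0w aw]] := al_H a Ha.
  have phiw : al (phi w) = al w.
    elim: H0w => {aw w} [_ [k ->] //||b b' _ e _ e'|b _ e].
    - by rewrite (hom1 phiM).
    - by rewrite phiM !alM e e'.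
    by rewrite (homV phiM) !alV e.
  have := al_phi_der (gmul (ginv w) a); rewrite phiM (homV phiM) !alM !alV phiw aw addNr.
  by move/(_ erefl)/eqP; rewrite addrC subr_eq0 => /eqP.
pose d m := (fl (phi m) - fl m)%R.
have dM a b : H a -> H b -> d (gmul a b) = (d a + act (al a) (d b))%R.
  move=> Ha Hb; rewrite /d phiM !flM al_phi // actD actN opprD.
  by rewrite [LHS]addrACA.
(* This is [fl_phic] expanded by the flow formula for commutators. *)
have dh k : (d (h k) - act (al (h j)) (d (h k)) = d (h j) - act (al (h k)) (d (h j)))%R.
  have [->//|jk] := eqVneq j k.
  have [k' ek _] := unlift_some jk.
  have := fl_phic k'; rewrite /c -ek (hom_lcomm _ _ phiM).
  rewrite !(fl_lcomm coords) !al_phih.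
  rewrite /d !actD !actN => e; apply/funext => z.
  have := congr1 (@^~ z) e; rewrite !fctE.
  lia.
pose D m := (d m - act (al (h j)) (d m) - (d (h j) - act (al m) (d (h j))))%R.
have D0 a : H a -> D a = 0%R.
  apply: (crossed_hom_eq0 (d := D) coords Hsub hH al_H).
  - by move=> b b' Hb Hb'; rewrite /D dM // alM crossed_sub_principal.
  - move=> b; have fd m : fsup (d m).
      by apply: fsupD; [|apply: fsupN]; exact: (fl_fsup hM coords).
    by apply: fsupD; [|apply: fsupN]; apply: fsupD => //; apply: fsupN; exact: fsup_act.
  - by move=> k; rewrite /D dh subrr.
  move=> b Hb b0; have [w wb] := gen_weval (free_metabelian_gen hM b).
  (* The single equation is repeated [l] times and read off at index 0, which exists because
     [1 <= l]. *)
  have [|z [Hz zw]] := hvc r (fun=> w) (fun=> b) (fun=> Hb); first by exists x.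
  exists w, z; split=> //; [exact: zw (Ordinal hl)|by rewrite wb].
apply: (retract_of_kernel_fix coords Hsub phiM Hphi al_phi) => a Ha a0.
apply: (magnus_inj hM coords); first by rewrite al_phi.
(* For [a] of trivial class the principal part vanishes, so [d a] is invariant under the nonzero
   translation [al (h j)]. *)
have := D0 a Ha; rewrite /D a0 act0 subrr subr0 => /eqP.
rewrite subr_eq0 eq_sym => /eqP da.
have /eqP : d a = 0%R by apply: act_fix da aj; apply: fsupD; [|apply: fsupN]; exact: (fl_fsup hM coords).
by rewrite subr_eq0 => /eqP.
Qed.
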